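(* Let $(X,d)$ be a pseudo-distance space (that is, $X$ is a nonempty set and $d:X^2\to[-\infty,\infty]$ is an arbitrary function). Suppose that $f:X\to\mathbb{R}$ is continuous and let $\emptyset\neq A\subseteq X$ be arbitrary. If $\mathrm{SUP}_f(A)=\infty$, then for all $\mu\in\mathbb{R}$ there exists $\delta>0$ such that for each nonempty subset $A'\subseteq X$ satisfying $D_{asyH}(A,A')<\delta$ (in particular, for each $\emptyset\neq A'\subseteq X$ satisfying $D_H(A,A')<\delta$), one has $\mu<\mathrm{SUP}_f(A')$. Similarly, if $\mathrm{INF}_f(A)=-\infty$, then for all $\mu\in\mathbb{R}$ there exists $\delta>0$ such that for each nonempty subset $A'\subseteq X$ satisfying $D_{asyH}(A,A')<\delta$ (in particular, for each $\emptyset\neq A'\subseteq X$ satisfying $D_H(A,A')<\delta$), one has $\mathrm{INF}_f(A')<\mu$.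
   Context: A pseudo-distance space $(X,d)$ is a nonempty set $X$ with an arbitrary function $d:X^2\to[-\infty,\infty]$ (no symmetry, nonnegativity, finiteness or triangle inequality is assumed). For $f:X\to\mathbb{R}$ and $A\subseteq X$: $\mathrm{SUP}_f(A):=\sup\{f(a):a\in A\}$ and $\mathrm{INF}_f(A):=\inf\{f(a):a\in A\}$. For $x\in X$ and nonempty $A,A'\subseteq X$: $d(x,A):=\inf\{d(x,a):a\in A\}$, $D_{asyH}(A,A'):=\sup\{d(a,A'):a\in A\}$, and $D_H(A,A'):=\max\{D_{asyH}(A,A'),D_{asyH}(A',A)\}$, all in $[-\infty,\infty]$. The function $f:X\to\mathbb{R}$ is continuous at $x\in X$ if for every $\epsilon>0$ there exists $\delta>0$ such that for each $y\in X$ satisfying $d(x,y)<\delta$ one has $|f(x)-f(y)|<\epsilon$; it is continuous if it is continuous at each $x\in X$. *)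

(* Defs.v *)
From HB Require Import structures.
From mathcomp Require Import all_boot all_order all_algebra.
From mathcomp Require Import classical_sets reals ereal.

Set Implicit Arguments.
Unset Strict Implicit.
Unset Printing Implicit Defensive.

Import Order.TTheory GRing.Theory Num.Theory.
Local Open Scope classical_set_scope.
Local Open Scope ring_scope.
Local Open Scope ereal_scope.

(* A pseudo-distance is an arbitrary function [d : X -> X -> \bar R].  It
   induces no topology on [X] in general, so continuity is the
   epsilon-delta condition below and not the library's [continuous]. *)

Definition SUP (R : realType) (X : Type) (f : X -> R) (A : set X) : \bar R :=
  ereal_sup [set (f a)%:E | a in A].

Definition INF (R : realType) (X : Type) (f : X -> R) (A : set X) : \bar R :=
  ereal_inf [set (f a)%:E | a in A].

Definition dist_to_set (R : realType) (X : Type) (d : X -> X -> \bar R)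
    (x : X) (A : set X) : \bar R :=
  ereal_inf [set d x a | a in A].

Definition DasyH (R : realType) (X : Type) (d : X -> X -> \bar R)
    (A A' : set X) : \bar R :=
  ereal_sup [set dist_to_set d a A' | a in A].

Definition DH (R : realType) (X : Type) (d : X -> X -> \bar R)
    (A A' : set X) : \bar R :=
  Order.max (DasyH d A A') (DasyH d A' A).

Definition pd_continuous_at (R : realType) (X : Type) (d : X -> X -> \bar R)
    (f : X -> R) (x : X) : Prop :=
  forall eps : R, (0 < eps)%R ->
    exists2 delta : R, (0 < delta)%R &
      forall y : X, d x y < delta%:E -> (`|f x - f y| < eps)%R.

Definition pd_continuous (R : realType) (X : Type) (d : X -> X -> \bar R)
    (f : X -> R) : Prop :=
  forall x : X, pd_continuous_at d f x.

(* Main.v *)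
Require Import Defs.
From HB Require Import structures.
From mathcomp Require Import all_boot all_order all_algebra.
From mathcomp Require Import classical_sets reals ereal.
From mathcomp Require Import lra.

(** An unbounded supremum over [A] is witnessed, at any prescribed height, by
    a single point [a] of [A], and the radius can be taken from the continuity
    of [f] at that one point.  Choose [a] with [f a > mu + 1] and [delta]
    from the continuity of [f] at [a] with tolerance [1].  As [DasyH d A A'] is
    a supremum over [A] of infima over [A'], the bound [DasyH d A A' < delta]
    provides [a'] in [A'] with [d a a' < delta], hence [f a' > mu].  The point
    [a'] depends on [A'], but [delta] does not, since [a] is fixed before [A']
    is given; this is [near_value_in_DasyH_close_set].  The infimum is treated
    in the same way, starting from [f a < mu - 1], and [DH] dominates
    [DasyH]. *)

Set Implicit Arguments.
Unset Strict Implicit.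
Unset Printing Implicit Defensive.

Import Order.TTheory GRing.Theory Num.Theory.
Local Open Scope classical_set_scope.
Local Open Scope ring_scope.
Local Open Scope ereal_scope.

Section AsymmetricHausdorff.
Variables (R : realType) (X : Type) (d : X -> X -> \bar R).
Implicit Types (A B : set X) (f : X -> R).

Lemma DasyH_lt_exists A B (r : \bar R) (a : X) :
  A a -> DasyH d A B < r -> exists2 b, B b & d a b < r.
Proof.
move=> Aa /(le_lt_trans _) AB_lt.
have /ereal_inf_lt[_ [b Bb <-] dab] : dist_to_set d a B < r.
  by apply: AB_lt; apply: ereal_sup_ubound; exists a.
by exists b.
Qed.

Lemma DasyH_le_DH A B : DasyH d A B <= DH d A B.
Proof. by rewrite /DH le_max lexx. Qed.

(** The radius is chosen from [a] and [eps] alone, before [B]: this order of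
    quantifiers is what makes one radius work for every set [B] close to
    [A]. *)
Lemma near_value_in_DasyH_close_set f A (a : X) (eps : R) :
    pd_continuous_at d f a -> A a -> (0 < eps)%R ->
  exists2 delta : R, (0 < delta)%R &
    forall B, DasyH d A B < delta%:E ->
      exists2 b, B b & (`|f a - f b| < eps)%R.
Proof.
move=> f_cont Aa /f_cont[delta delta_gt0 f_near]; exists delta => // B.
by move=> /(DasyH_lt_exists Aa)[b Bb /f_near fab]; exists b.
Qed.

Lemma SUP_gt_exists f A (r : R) : r%:E < SUP f A -> exists2 a, A a & (r < f a)%R.
Proof. by move=> /ereal_sup_gt[_ [a Aa <-]]; rewrite lte_fin; exists a. Qed.

Lemma INF_lt_exists f A (r : R) : INF f A < r%:E -> exists2 a, A a & (f a < r)%R.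
Proof. by move=> /ereal_inf_lt[_ [a Aa <-]]; rewrite lte_fin; exists a. Qed.

Lemma lt_SUP f A (r : R) (a : X) : A a -> (r < f a)%R -> r%:E < SUP f A.
Proof.
move=> Aa r_lt; apply: (@lt_le_trans _ _ (f a)%:E); first by rewrite lte_fin.
by apply: ereal_sup_ubound; exists a.
Qed.

Lemma INF_lt f A (r : R) (a : X) : A a -> (f a < r)%R -> INF f A < r%:E.
Proof.
move=> Aa lt_r; apply: (@le_lt_trans _ _ (f a)%:E); last by rewrite lte_fin.
by apply: ereal_inf_lbound; exists a.
Qed.

End AsymmetricHausdorff.

Theorem theorem3p2 (R : realType) (X : Type) (X_nonempty : [set: X] !=set0)
    (d : X -> X -> \bar R) (f : X -> R) (f_cont : pd_continuous d f)
    (A : set X) (A_nonempty : A !=set0) :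
  (SUP f A = +oo ->
     forall mu : R, exists2 delta : R, (0 < delta)%R &
       (forall A' : set X, A' !=set0 -> DasyH d A A' < delta%:E ->
          mu%:E < SUP f A') /\
       (forall A' : set X, A' !=set0 -> DH d A A' < delta%:E ->
          mu%:E < SUP f A')) /\
  (INF f A = -oo ->
     forall mu : R, exists2 delta : R, (0 < delta)%R &
       (forall A' : set X, A' !=set0 -> DasyH d A A' < delta%:E ->
          INF f A' < mu%:E) /\
       (forall A' : set X, A' !=set0 -> DH d A A' < delta%:E ->
          INF f A' < mu%:E)).
Proof.
split=> [supA | infA] mu.
- have [a Aa mu_lt] : exists2 a, A a & (mu + 1 < f a)%R.
    by apply: SUP_gt_exists; rewrite supA ltry.
  have [delta delta_gt0 near] :=
    near_value_in_DasyH_close_set (f_cont a) Aa ltr01.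
  have close A' : DasyH d A A' < delta%:E -> mu%:E < SUP f A'.
    move=> /near[b A'b]; rewrite ltr_norml => /andP[_ fab].
    by apply: (lt_SUP A'b); lra.
  exists delta => //; split=> A' _; first exact: close.
  by move=> /(le_lt_trans (DasyH_le_DH _ _ _))/close.
- have [a Aa lt_mu] : exists2 a, A a & (f a < mu - 1)%R.
    by apply: INF_lt_exists; rewrite infA ltNyr.
  have [delta delta_gt0 near] :=
    near_value_in_DasyH_close_set (f_cont a) Aa ltr01.
  have close A' : DasyH d A A' < delta%:E -> INF f A' < mu%:E.
    move=> /near[b A'b]; rewrite ltr_norml => /andP[fab _].
    by apply: (INF_lt A'b); lra.
  exists delta => //; split=> A' _; first exact: close.
  by move=> /(le_lt_trans (DasyH_le_DH _ _ _))/close.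
Qed.
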